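(* Let $\mathcal C,\mathcal D$ be stable configuration structures. Then $\mathcal C$ and $\mathcal D$ are hereditary weak history-preserving (HWH) bisimilar if and only if $\mathcal C\equiv_{\mathrm{EIL}_{hwh}}\mathcal D$.
   Context: Configuration structures. A configuration structure over $\mathsf{Act}$ is $\mathcal C=(C,\ell)$, $C$ a family of finite sets (configurations), $\ell:\bigcup_{X\in C}X\to\mathsf{Act}$, events $E_{\mathcal C}=\bigcup C$. Stable: $\emptyset\in C$; every nonempty $X\in C$ has $e\in X$ with $X\setminus\{e\}\in C$; for $X,Y,Z\in C$ with $X\cup Y\subseteq Z$, $X\cup Y\in C$ and $X\cap Y\in C$. For $X\in C$: $d\le_Xe$ iff every $Y\in C$ with $Y\subseteq X$ and $e\in Y$ contains $d$; $d<_Xe$ iff $d\le_Xe$, $d\neq e$. $X\xrightarrow{e}X'$ iff $X,X'\in C$, $X\subseteq X'$, $X'\setminus X=\{e\}$; $X\xrightarrow{a}X'$ iff $X\xrightarrow{e}X'$, $\ell(e)=a$. Standing assumption: image finiteness. $f:X\cong Y$ means $f$ is a label-preserving bijection with $d<_Xe\iff f(d)<_Yf(e)$. HWH bisimulation. $\mathcal R\subseteq C_{\mathcal C}\times C_{\mathcal D}\times\mathcal P(E_{\mathcal C}\times E_{\mathcal D})$ with $\mathcal R(\emptyset,\emptyset,\emptyset)$ such that whenever $\mathcal R(X,Y,f)$, $a\in\mathsf{Act}$: $f:X\cong Y$; if $X\xrightarrow{a}X'$ then $\exists Y',f'$ with $Y\xrightarrow{a}Y'$ and $\mathcal R(X',Y',f')$,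 and symmetrically for $Y\xrightarrow{a}Y'$; if $X'\xrightarrow{a}X$ then $\exists Y',f'$ with $Y'\xrightarrow{a}Y$, $\mathcal R(X',Y',f')$ and $f\restriction X'=f'$, and symmetrically for $Y'\xrightarrow{a}Y$. EIL. Syntax $\phi::=\mathrm{tt}\mid\neg\phi\mid\phi\wedge\phi'\mid\langle x:a\rangle\phi\mid(x:a)\phi\mid\langle\!\langle x\rangle\!\rangle\phi$; $\langle x:a\rangle,(x:a)$ bind $x$; $\mathrm{fi}(\langle\!\langle x\rangle\!\rangle\phi)=\mathrm{fi}(\phi)\cup\{x\}$, other clauses as usual; closed = no free identifiers. Environment $\rho$ permissible for $\phi$ and $X$: $\mathrm{fi}(\phi)\subseteq\mathrm{dom}\rho$, $\rho(\mathrm{fi}(\phi))\subseteq X$. Semantics: $\mathrm{tt},\neg,\wedge$ classical; $X,\rho\models\langle x:a\rangle\phi$ iff $\exists X',e$: $X\xrightarrow{e}X'$, $\ell(e)=a$, $X',\rho[x\mapsto e]\models\phi$; $X,\rho\models(x:a)\phi$ iff $\exists e\in X$, $\ell(e)=a$, $X,\rho[x\mapsto e]\models\phi$; $X,\rho\models\langle\!\langle x\rangle\!\rangle\phi$ iff $\exists X',e$: $X'\xrightarrow{e}X$, $\rho(x)=e$, $\rho$ permissible for $\phi$ and $X'$, $X',\rho\models\phi$. For closed $\phi$: $\mathcal C\models\phi$ iff $\emptyset,\emptyset\models\phi$. $\mathcal C\equiv_L\mathcal D$ iff for all closed $\phi\in L$: $\mathcal C\models\phi\iff\mathcal D\models\phi$.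 $\langle a\rangle\phi$ abbreviates $\langle x:a\rangle\phi$ with $x$ not free in $\phi$. Sublogic $\mathrm{EIL}_{hwh}$: $\phi::=\mathrm{tt}\mid\neg\phi\mid\phi\wedge\phi'\mid\langle a\rangle\phi_c\mid(x:a)\phi\mid\langle\!\langle x\rangle\!\rangle\phi$, where $\phi_c$ ranges over closed formulas of $\mathrm{EIL}_{hwh}$. *)

(* Defs.v *)
From HB Require Import structures.
From mathcomp Require Import all_boot.
From mathcomp Require Import boolp classical_sets functions cardinality.

Set Implicit Arguments.
Unset Strict Implicit.
Unset Printing Implicit Defensive.

Local Open Scope classical_set_scope.

(* The carrier [ev] may be larger than the set [events] of elements occurring
   in some configuration; labels and elements outside [events] play no role. *)
Record conf_struct (Act : Type) := ConfStruct {
  ev : Type;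
  conf : set (set ev);
  label : ev -> Act;
  conf_finite : forall X, conf X -> finite_set X
}.

Arguments conf {Act} c.

Section ConfigurationStructures.
Variables (Act : Type) (C : conf_struct Act).
Implicit Types (X Y Z : set (ev C)) (d e : ev C) (a : Act).

Definition events : set (ev C) := \bigcup_(X in conf C) X.

Definition stable : Prop :=
  [/\ conf C set0,
      forall X, conf C X -> X !=set0 -> exists2 e, X e & conf C (X `\ e)
    & forall X Y Z, conf C X -> conf C Y -> conf C Z -> X `|` Y `<=` Z ->
        conf C (X `|` Y) /\ conf C (X `&` Y)].

Definition causal_le X d e : Prop :=
  forall Y, conf C Y -> Y `<=` X -> Y e -> Y d.

Definition causal_lt X d e : Prop := causal_le X d e /\ d <> e.

Definition ev_step X e X' : Prop :=
  [/\ conf C X, conf C X', X `<=` X' & X' `\` X = [set e]].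

Definition act_step X a X' : Prop :=
  exists2 e, ev_step X e X' & label e = a.

Definition image_finite : Prop :=
  forall X a, conf C X -> finite_set [set X' | act_step X a X'].

End ConfigurationStructures.

Arguments events {Act} C.

Section Bisimulation.
Variables (Act : Type) (C D : conf_struct Act).

(* A bijection [X -> Y] is represented by its graph. *)
Definition conf_iso (X : set (ev C)) (Y : set (ev D))
    (f : set (ev C * ev D)) : Prop :=
  [/\ f `<=` X `*` Y,
      forall d, X d -> exists! d', f (d, d'),
      forall d', Y d' -> exists! d, f (d, d'),
      forall d d', f (d, d') -> label d = label d'
    & forall d d' e e', f (d, d') -> f (e, e') ->
        (causal_lt X d e <-> causal_lt Y d' e')].

Definition graph_restrict (f : set (ev C * ev D)) (X : set (ev C)) :
    set (ev C * ev D) :=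
  [set p | f p /\ X p.1].

Definition hwh_bisimulation
    (R : set (ev C) -> set (ev D) -> set (ev C * ev D) -> Prop) : Prop :=
  [/\ forall X Y f, R X Y f ->
        [/\ conf C X, conf D Y & f `<=` events C `*` events D],
      R set0 set0 set0
    & forall X Y f a, R X Y f ->
      [/\ conf_iso X Y f,
          forall X', act_step X a X' ->
            exists Y' f', act_step Y a Y' /\ R X' Y' f',
          forall Y', act_step Y a Y' ->
            exists X' f', act_step X a X' /\ R X' Y' f',
          forall X', act_step X' a X ->
            exists Y' f', [/\ act_step Y' a Y, R X' Y' f'
                            & graph_restrict f X' = f']
        & forall Y', act_step Y' a Y ->
            exists X' f', [/\ act_step X' a X, R X' Y' f'
                            & graph_restrict f X' = f']]].

Definition hwh_bisimilar : Prop := exists R, hwh_bisimulation R.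

End Bisimulation.

Section EventIdentifierLogic.
Variables (Act : Type) (Id : choiceType).

(* [Fwd x a phi] is <x:a>phi, [Bind x a phi] is (x:a)phi and
   [Rev x phi] is <<x>>phi. *)
Inductive formula : Type :=
| Tt
| Neg of formula
| And of formula & formula
| Fwd of Id & Act & formula
| Bind of Id & Act & formula
| Rev of Id & formula.

Fixpoint fi (phi : formula) : set Id :=
  match phi with
  | Tt => set0
  | Neg phi => fi phi
  | And phi psi => fi phi `|` fi psi
  | Fwd x _ phi => fi phi `\ x
  | Bind x _ phi => fi phi `\ x
  | Rev x phi => fi phi `|` [set x]
  end.

Definition closed_formula (phi : formula) : Prop := fi phi = set0.

(* The side condition that x is not free in the body of [Fwd x a phi] is
   subsumed by the closedness of the body. *)
Inductive EIL_hwh : formula -> Prop :=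
| hwh_Tt : EIL_hwh Tt
| hwh_Neg phi : EIL_hwh phi -> EIL_hwh (Neg phi)
| hwh_And phi psi : EIL_hwh phi -> EIL_hwh psi -> EIL_hwh (And phi psi)
| hwh_Fwd x a phi : EIL_hwh phi -> closed_formula phi -> EIL_hwh (Fwd x a phi)
| hwh_Bind x a phi : EIL_hwh phi -> EIL_hwh (Bind x a phi)
| hwh_Rev x phi : EIL_hwh phi -> EIL_hwh (Rev x phi).

Section Semantics.
Variable C : conf_struct Act.

Definition env : Type := Id -> option (ev C).

Definition empty_env : env := fun=> None.

Definition update (rho : env) (x : Id) (e : ev C) : env :=
  fun y => if y == x then Some e else rho y.

Definition permissible (rho : env) (phi : formula) (X : set (ev C)) : Prop :=
  forall x, fi phi x -> exists2 e, rho x = Some e & X e.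

(* Only meaningful when [rho] is permissible for [phi] and [X]. *)
Fixpoint sat (X : set (ev C)) (rho : env) (phi : formula) : Prop :=
  match phi with
  | Tt => True
  | Neg phi => ~ sat X rho phi
  | And phi psi => sat X rho phi /\ sat X rho psi
  | Fwd x a phi => exists X' e,
      [/\ ev_step X e X', label e = a & sat X' (update rho x e) phi]
  | Bind x a phi => exists e,
      [/\ X e, label e = a & sat X (update rho x e) phi]
  | Rev x phi => exists X' e,
      [/\ ev_step X' e X, rho x = Some e, permissible rho phi X'
        & sat X' rho phi]
  end.

Definition models (phi : formula) : Prop := sat set0 empty_env phi.

End Semantics.

Definition logic_equiv (L : formula -> Prop) (C D : conf_struct Act) : Prop :=
  forall phi, L phi -> closed_formula phi -> (models C phi <-> models D phi).

End EventIdentifierLogic.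

(* Main.v *)
(* Soundness is an induction on formulas: only a reverse step consults the
   identifiers, and there the restricted isomorphism forces the undone events to
   correspond.

   For completeness, relate X and Y when their events are named by the same
   identifiers and they agree on all formulas over those names. Undoing an event
   is deterministic once the event is named, so agreement descends along reverse
   steps; in a stable structure every configuration inside X is reached from X by
   such steps, hence the bijection given by the names preserves causality. For a
   forward step the names are forgotten, image finiteness yields a successor
   agreeing on closed formulas, and the events of the new configuration are then
   named one at a time: each binding step is a Hennessy-Milner argument over the
   finitely many events of Y. That the names thus obtained on the other side are
   a bijection follows by undoing all the events. *)

Require Import Defs.
From HB Require Import structures.
From mathcomp Require Import all_boot finmap.
From mathcomp Require Import boolp classical_sets functions cardinality.

Local Open Scope classical_set_scope.

Set Implicit Arguments.
Unset Strict Implicit.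
Unset Printing Implicit Defensive.

(** * Finite-set induction and reverse steps in stable structures *)

(** The induction hypothesis covers the removal of every element, because stability dictates which
    event may leave a configuration. *)
Lemma setD1_ind (T : Type) (P : set T -> Prop) :
  (forall A, finite_set A -> (forall x, A x -> P (A `\ x)) -> P A) ->
  forall A, finite_set A -> P A.
Proof.
(* Cardinality goes through [fset_set], which asks for a choice type; [{classic T}] supplies one. *)
suff ind (U : choiceType) (Q : set U -> Prop) :
    (forall A, finite_set A -> (forall x, A x -> Q (A `\ x)) -> Q A) ->
    forall A, finite_set A -> Q A.
  exact: (ind {classic T} P).
move=> hQ A finA; have [n] := ubnP #|` fset_set A|%fset.
elim: n A finA => // n IH A finA /ltnSE hA; apply: hQ => // x Ax.
apply: IH; first exact: finite_setD.
apply: leq_trans hA.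
by rewrite fset_setD1 // (cardfsD1 x (fset_set A)) in_fset_set // mem_set.
Qed.

Section Structures.
Variables (Act : Type) (C : conf_struct Act).
Implicit Types (X Y Z W : set (ev C)) (e : ev C).

Lemma ev_stepE X e X' :
  ev_step X e X' <-> [/\ conf C X, conf C X', X' e & X = X' `\ e].
Proof.
split=> [[cX cX' sXX' dXX']|[cX cX' eX' eqX]].
  have [X'e nXe] : (X' `\` X) e by rewrite dXX'.
  split=> //; apply/seteqP; split=> [d Xd|d [X'd nde]].
    by split; [exact: sXX' | move=> /= de; rewrite de in Xd].
  apply: contrapT => nXd; apply: nde.
  by have : (X' `\` X) d by []; rewrite dXX'.
split=> //; first by rewrite eqX; exact: subDsetl.
rewrite eqX setDD; apply/seteqP; split=> [d []//|d -> //].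
Qed.

Lemma ev_stepD1 X e : conf C X -> conf C (X `\ e) -> X e ->
  ev_step (X `\ e) e X.
Proof. by move=> cX cXe Xe; apply/ev_stepE. Qed.

(** Iterated, this descends from [X] to [Z] by reverse steps that never lose an event of [Z]. *)
Lemma stable_coatom Z X : stable C -> conf C Z -> conf C X -> Z `<=` X ->
  Z <> X -> exists e, [/\ X e, ~ Z e & conf C (X `\ e)].
Proof.
move=> [_ stD stUI] cZ cX sZX nZX.
suff H W : finite_set W -> conf C W -> W `<=` X -> Z `|` W = X ->
    exists e, [/\ X e, ~ Z e & conf C (X `\ e)].
  apply: (H X) => //; first exact: (conf_finite cX).
  by rewrite setUC; apply: setUidl.
(* Along a chain from the empty configuration up to X, the union with Z first
   reaches X at the sought event. *)
elim/setD1_ind : W / => W _ IH cW sWX ZWX.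
have [W0|/set0P W0] := eqVneq W set0.
  by case: nZX; rewrite -ZWX W0 setU0.
have [e We cWe] := stD _ cW W0.
have sWeX : W `\ e `<=` X by move=> d [Wd _]; exact: sWX.
have sU : Z `|` W `\ e `<=` X by move=> d [/sZX//|/sWeX].
have [ZWe|ZWe] := eqVneq (Z `|` W `\ e) X; first exact: (IH e).
have nZe : ~ Z e.
  move=> Ze; move/eqP: ZWe; apply; rewrite -ZWX.
  apply/seteqP; split=> d [Zd|]; [by left|by move=> [Wd _]; right|by left|].
  by move=> Wd; have [->|de] := pselect (d = e); [left|right].
exists e; split=> //; first exact: sWX.
have [cU _] := stUI _ _ _ cZ cWe cX sU.
suff -> : X `\ e = Z `|` W `\ e by [].
rewrite -ZWX; apply/seteqP; split=> d.
  by move=> [[Zd|Wd] de]; [left|right].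
by move=> [Zd|[Wd de]]; split=> //; [left|move=> /= de; rewrite de in Zd|right].
Qed.

End Structures.

(** * Soundness: bisimilar structures satisfy the same formulas *)

Section BisimulationSoundness.
Variables (Act : Type) (Id : choiceType) (C D : conf_struct Act).
Implicit Types (X : set (ev C)) (Y : set (ev D)) (f : set (ev C * ev D)).
Implicit Types (phi : formula Act Id).

(** Only identifiers in [P] are constrained, so for a closed formula the condition is vacuous and
    [f] may be exchanged for any other relation. *)
Definition related_env f (P : set Id) (rho : env Id C) (rho' : env Id D) :=
  forall x, P x -> exists d d', [/\ rho x = Some d, rho' x = Some d' & f (d, d')].

Lemma related_env_update f (P : set Id) x e e' rho rho' :
  related_env f (P `\ x) rho rho' -> f (e, e') ->
  related_env f P (update rho x e) (update rho' x e').
Proof.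
move=> hrel fee y Py; rewrite /update; case: eqP => yx; first by exists e, e'.
by apply: hrel; split.
Qed.

Lemma conf_iso_inj X Y f d e d' : conf_iso X Y f -> f (d, d') -> f (e, d') -> d = e.
Proof.
move=> [sf _ fu _ _] fd fe.
have [_ /= Yd'] := sf _ fd.
have [u [_ uu]] := fu _ Yd'.
by rewrite -(uu _ fd) -(uu _ fe).
Qed.

Lemma conf_iso_fun X Y f d d' e' : conf_iso X Y f -> f (d, d') -> f (d, e') -> d' = e'.
Proof.
move=> [sf fu _ _ _] fd fe.
have [/= Xd _] := sf _ fd.
have [u [_ uu]] := fu _ Xd.
by rewrite -(uu _ fd) -(uu _ fe).
Qed.

Lemma conf_iso_img X Y f d d' : conf_iso X Y f -> f (d, d') -> X d /\ Y d'.
Proof. by move=> [sf _ _ _ _] /sf[]. Qed.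

(** If the partner of [e] were not [e'], it would survive in [Y'] and have a preimage in [X']; by
    injectivity of [f] that preimage is [e], which is absent from [X']. *)
Lemma restrict_step_event X Y X' Y' f e e' :
  conf_iso X Y f -> conf_iso X' Y' (graph_restrict f X') ->
  ev_step X' e X -> ev_step Y' e' Y -> f (e, e').
Proof.
move=> iso iso' /ev_stepE[_ _ Xe eX'] /ev_stepE[_ _ Ye' eY'].
have [_ fX _ _ _] := iso.
have [e1 [fe1 _]] := fX _ Xe.
have [_ Ye1] := conf_iso_img iso fe1.
have [<-//|ne] := pselect (e1 = e').
have Y'e1 : Y' e1 by rewrite eY'.
have [_ _ fY' _ _] := iso'.
have [d [[fd X'd] _]] := fY' _ Y'e1.
by move: X'd; rewrite /= (conf_iso_inj iso fd fe1) eX' => -[_ /(_ erefl)].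
Qed.

Lemma hwh_bisimulation_sat R phi : hwh_bisimulation R -> EIL_hwh phi ->
  forall X Y f rho rho', R X Y f -> related_env f (fi phi) rho rho' ->
  sat X rho phi <-> sat Y rho' phi.
Proof.
move=> [_ _ hR]; elim=> {phi} //=.
- by move=> phi _ IH X Y f rho rho' RXY hrel; rewrite (IH _ _ _ _ _ RXY hrel).
- move=> phi psi _ IH1 _ IH2 X Y f rho rho' RXY hrel.
  rewrite (IH1 _ _ _ rho rho' RXY) ?(IH2 _ _ _ rho rho' RXY) // => x hx.
    by apply: hrel; right.
  by apply: hrel; left.
- move=> x a phi _ IH cl X Y f rho rho' RXY _.
  (* The bijection after a forward step is unrelated to [f]; closedness of the body makes this
     harmless. *)
  have no_ids f' r r' : related_env f' (fi phi) r r' by move=> y; rewrite cl.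
  have [_ hX hY _ _] := hR _ _ _ a RXY.
  split=> [[X' [e [st la hs]]]|[Y' [e' [st la hs]]]].
    have [|Y' [f' [[e' st' la'] RXY']]] := hX X'; first by exists e.
    by exists Y', e'; split=> //; apply: (IH _ _ _ _ _ RXY' (no_ids _ _ _)).1 hs.
  have [|X' [f' [[e st' la'] RXY']]] := hY Y'; first by exists e'.
  by exists X', e; split=> //; apply: (IH _ _ _ _ _ RXY' (no_ids _ _ _)).2 hs.
- move=> x a phi _ IH X Y f rho rho' RXY hrel.
  have [iso _ _ _ _] := hR _ _ _ a RXY.
  have [_ fX fY lf _] := iso.
  split=> [[e [Xe la hs]]|[e' [Ye la hs]]].
    have [e' [fe _]] := fX _ Xe; exists e'; split; rewrite -?(lf _ _ fe) //.
      exact: (conf_iso_img iso fe).2.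
    by apply/(IH _ _ _ _ _ RXY (related_env_update hrel fe)).
  have [e [fe _]] := fY _ Ye; exists e; split; rewrite ?(lf _ _ fe) //.
    exact: (conf_iso_img iso fe).1.
  by apply/(IH _ _ _ _ _ RXY (related_env_update hrel fe)).
- move=> x phi _ IH X Y f rho rho' RXY hrel.
  have [d [d' [rx rx' fdd']]] : exists d d',
    [/\ rho x = Some d, rho' x = Some d' & f (d, d')] by apply: hrel; right.
  split=> [[X' [e [st re pm hs]]]|[Y' [e' [st re pm hs]]]].
    have [iso _ _ hX _] := hR _ _ _ (label e) RXY.
    have [|Y' [f' [[e' st' _] RXY' ff']]] := hX X'; first by exists e.
    have [iso' _ _ _ _] := hR _ _ _ (label e) RXY'.
    move: re; rewrite rx => -[de]; rewrite {}de in rx fdd'.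
    rewrite -ff' in iso'.
    have fe := restrict_step_event iso iso' st st'.
    have hrel' : related_env f' (fi phi) rho rho'.
      move=> y hy; have [|u [u' [ru ru' fu]]] := hrel y; first by left.
      exists u, u'; split=> //; rewrite -ff'; split=> //=.
      by have [v] := pm _ hy; rewrite ru => -[<-].
    exists Y', e'; split=> //; last exact/(IH _ _ _ _ _ RXY' hrel').
      by rewrite (conf_iso_fun iso fe fdd').
    move=> y hy; have [u [u' [_ ru' fu]]] := hrel' _ hy.
    by exists u' => //; rewrite -ff' in fu; exact: (conf_iso_img iso' fu).2.
  have [iso _ _ _ hY] := hR _ _ _ (label e') RXY.
  have [|X' [f' [[e st' _] RXY' ff']]] := hY Y'; first by exists e'.
  have [iso' _ _ _ _] := hR _ _ _ (label e) RXY'.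
  move: re; rewrite rx' => -[de]; rewrite {}de in rx' fdd'.
  rewrite -ff' in iso'.
  have fe := restrict_step_event iso iso' st' st.
  have hrel' : related_env f' (fi phi) rho rho'.
    move=> y hy; have [|u [u' [ru ru' fu]]] := hrel y; first by left.
    exists u, u'; split=> //; rewrite -ff'.
    (* Restriction concerns the first component, while permissibility here speaks of the second: the
       preimage in [X'] of [u'] has to be identified with [u] by injectivity. *)
    have [v] := pm _ hy; rewrite ru' => -[<-] Y'u'.
    have [_ _ fY' _ _] := iso'.
    have [w [fw _]] := fY' _ Y'u'.
    by rewrite (conf_iso_inj iso fu fw.1).
  exists X', e; split=> //; last exact/(IH _ _ _ _ _ RXY' hrel').
    by rewrite (conf_iso_inj iso fe fdd').
  move=> y hy; have [u [u' [ru _ fu]]] := hrel' _ hy.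
  by exists u => //; rewrite -ff' in fu; exact: (conf_iso_img iso' fu).1.
Qed.

Lemma hwh_bisimilar_logic_equiv :
  hwh_bisimilar C D -> logic_equiv (@EIL_hwh Act Id) C D.
Proof.
move=> [R hR] phi Lphi cl; have [_ R0 _] := hR.
by apply: (hwh_bisimulation_sat hR Lphi R0) => x; rewrite cl.
Qed.

End BisimulationSoundness.

(** * Agreement on the formulas over a set of names *)

Section Agreement.
Variables (Act : Type) (Id : choiceType).
Implicit Types (s : set Id) (x y : Id).

(** At [s = set0] this is agreement on closed formulas, which is all that a forward step can
    preserve. *)
Definition agree (C D : conf_struct Act) (X : set (ev C)) (Y : set (ev D)) s
    (rho : env Id C) (rho' : env Id D) :=
  forall phi : formula Act Id, EIL_hwh phi -> fi phi `<=` s ->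
    sat X rho phi <-> sat Y rho' phi.

Definition maps_into (C : conf_struct Act) s (rho : env Id C) (X : set (ev C)) :=
  forall x, s x -> exists2 e, rho x = Some e & X e.

Definition naming (C : conf_struct Act) s (rho : env Id C) (X : set (ev C)) :=
  [/\ maps_into s rho X,
      forall x y, s x -> s y -> rho x = rho y -> x = y
    & forall e, X e -> exists2 x, s x & rho x = Some e].

Lemma agree_sym (C D : conf_struct Act) (X : set (ev C)) (Y : set (ev D)) s rho rho' :
  agree X Y s rho rho' -> agree Y X s rho' rho.
Proof. by move=> h phi Lphi sphi; rewrite h. Qed.

Lemma agree_sub (C D : conf_struct Act) (X : set (ev C)) (Y : set (ev D)) s t rho rho' :
  s `<=` t -> agree X Y t rho rho' -> agree X Y s rho rho'.
Proof. by move=> st h phi Lphi sphi; apply: h => // x /sphi/st. Qed.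

Lemma eq_sat (C : conf_struct Act) (phi : formula Act Id) (X : set (ev C))
    (rho sigma : env Id C) :
  (forall x, fi phi x -> rho x = sigma x) -> sat X rho phi <-> sat X sigma phi.
Proof.
have upd (psi : formula Act Id) x e (r r' : env Id C) : (forall y, (fi psi `\ x) y -> r y = r' y) ->
    forall y, fi psi y -> update r x e y = update r' x e y.
  by move=> h y hy; rewrite /update; case: eqP => // yx; apply: h; split.
elim: phi X rho sigma => //=.
- by move=> phi IH X rho sigma h; rewrite (IH _ _ _ h).
- move=> phi IH1 psi IH2 X rho sigma h.
  rewrite (IH1 _ rho sigma) ?(IH2 _ rho sigma) // => x hx; apply: h.
    by right.
  by left.
- move=> x a phi IH X rho sigma h.
  have E X' e := IH X' _ _ (upd phi x e _ _ h).
  by split=> -[X' [e [st la /E hs]]]; exists X', e.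
- move=> x a phi IH X rho sigma h.
  have E e := IH X _ _ (upd phi x e _ _ h).
  by split=> -[e [Xe la /E hs]]; exists e.
- move=> x phi IH X rho sigma h.
  have hx : rho x = sigma x by apply: h; right.
  have hp y : fi phi y -> rho y = sigma y by move=> hy; apply: h; left.
  split=> -[X' [e [st re pm hs]]]; exists X', e; split=> //.
  + by rewrite -hx.
  + by move=> y hy; rewrite -hp //; apply: pm.
  + by apply/(IH _ _ _ hp).
  + by rewrite hx.
  + by move=> y hy; rewrite hp //; apply: pm.
  + by apply/(IH _ _ _ hp).
Qed.

(** Closure under negation allows the distinguishing formula to be oriented so that it holds at
    [X]. *)
Lemma not_agree_distinguish (C D : conf_struct Act) (X : set (ev C)) (Y : set (ev D))
    s rho rho' :
  ~ agree X Y s rho rho' ->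
  exists phi : formula Act Id,
    [/\ EIL_hwh phi, fi phi `<=` s, sat X rho phi & ~ sat Y rho' phi].
Proof.
apply: contra_notP => nex phi Lphi sphi; split=> h.
  by apply: contrapT => h'; apply: nex; exists phi.
apply: contrapT => h'; apply: nex; exists (Neg phi).
by split=> //=; exact: hwh_Neg.
Qed.

(** The conjunction of finitely many distinguishing formulas. Both [Y] and [rho'] vary with [u], so
    that the candidates can be events to bind as well as successor configurations. *)
Lemma distinguish_all (C D : conf_struct Act) (X : set (ev C)) s rho
    (U : Type) (A : set U) (Y : U -> set (ev D)) (rho' : U -> env Id D) :
  finite_set A -> (forall u, A u -> ~ agree X (Y u) s rho (rho' u)) ->
  exists phi : formula Act Id, [/\ EIL_hwh phi, fi phi `<=` s, sat X rho phi
    & forall u, A u -> ~ sat (Y u) (rho' u) phi].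
Proof.
elim/setD1_ind: A / => A _ IH nA.
have [A0|/set0P[u Au]] := eqVneq A set0.
  exists (@Tt Act Id); split=> //=; first exact: hwh_Tt.
  by move=> u; rewrite A0.
have [|phi [Lphi sphi hphi nphi]] := IH u Au.
  by move=> v [Av _]; exact: nA.
have [psi [Lpsi spsi hpsi npsi]] := not_agree_distinguish (nA u Au).
exists (And phi psi); split=> //=; first exact: hwh_And.
  by move=> x [/sphi|/spsi].
move=> v Av [h1 h2]; have [vu|vu] := pselect (v = u); first by rewrite vu in h2.
exact: (nphi v).
Qed.

(** Otherwise a single [phi] refutes every equally labelled event of [Y], and binding [x] in front
    of [phi] separates [X] from [Y]. *)
Lemma agree_bind (C D : conf_struct Act) (X : set (ev C)) (Y : set (ev D)) s x e
    rho rho' :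
  finite_set Y -> agree X Y s rho rho' -> X e ->
  exists e', [/\ Y e', label e' = label e
    & agree X Y (s `|` [set x]) (update rho x e) (update rho' x e')].
Proof.
move=> finY hXY Xe; apply: contrapT => nex.
have finA : finite_set (Y `&` [set e' | label e' = label e]).
  exact: finite_setIl.
have [e' [Ye' le'] h|phi [Lphi sphi hphi nphi]] :=
    @distinguish_all C D X (s `|` [set x]) (update rho x e) _ _
      (fun=> Y) (update rho' x) finA.
  by apply: nex; exists e'.
have : sat X rho (Bind x (label e) phi) by exists e.
move=> /hXY[]; first exact: hwh_Bind.
  by move=> y /= [/sphi[//|->] /(_ erefl)].
by move=> e' [Ye' le' he']; exact: (nphi e').
Qed.

Lemma agree_fwd (C D : conf_struct Act) (X X' : set (ev C)) (Y : set (ev D)) x a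
    rho rho' :
  image_finite D -> conf D Y -> agree X Y set0 rho rho' -> act_step X a X' ->
  exists2 Y', act_step Y a Y' & agree X' Y' set0 rho rho'.
Proof.
move=> finD cY hXY [e st le]; apply: contrapT => nex.
have [Y' sY' h|phi [Lphi sphi hphi nphi]] :=
    @distinguish_all C D X' set0 rho _ _ id (fun=> rho') (finD Y a cY).
  by apply: nex; exists Y'.
have cl : closed_formula phi by apply/seteqP; split.
(* [Fwd] evaluates its body in an updated environment, which a closed body ignores. *)
have irr (E : conf_struct Act) (Z : set (ev E)) r r' : sat Z r phi <-> sat Z r' phi.
  by apply: eq_sat => y; rewrite cl.
have : sat X rho (Fwd x a phi) by exists X', e; split=> //; exact: (irr _ _ _ _).1 hphi.
move=> /hXY[]; first exact: hwh_Fwd.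
  by move=> y /= [/sphi].
move=> Y' [e' [st' le' he']]; apply: (nphi Y'); first by exists e'.
exact: (irr _ _ _ _).1 he'.
Qed.

(** The undone event of [Y] must be the one that [rho'] assigns to [x], so the target [Y'] is
    unique. The existential in [Rev] then speaks of this one configuration, and formulas true at
    [X'] transfer to it; negation gives the converse. *)
Lemma agree_rev (C D : conf_struct Act) (X X' : set (ev C)) (Y : set (ev D)) s x e
    rho rho' :
  agree X Y s rho rho' -> naming s rho X -> ev_step X' e X ->
  s x -> rho x = Some e ->
  exists Y' e', [/\ ev_step Y' e' Y, rho' x = Some e',
    maps_into (s `\ x) rho' Y' & agree X' Y' (s `\ x) rho rho'].
Proof.
move=> hXY [ns inj _] st sx rx; have [_ _ Xe eX'] := (ev_stepE _ _ _).1 st.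
have step phi : EIL_hwh phi -> fi phi `<=` s `\ x -> sat X' rho phi ->
    sat Y rho' (Rev x phi).
  move=> Lphi sphi hphi; apply/hXY; first exact: hwh_Rev.
    by move=> y /= [/sphi[]//|->].
  exists X', e; split=> // y /sphi[sy yx]; have [d rd Xd] := ns _ sy.
  exists d => //; rewrite eX'; split=> // de.
  by apply: yx; apply: inj => //; rewrite rd rx de.
(* The trivial body produces the target; every other body is then shown to lead to the same one. *)
have [Y' [e' [st' re' _ _]]] : sat Y rho' (Rev x (@Tt Act Id)).
  by apply: step => //; exact: hwh_Tt.
have [_ _ _ eY'] := (ev_stepE _ _ _).1 st'.
have {}step phi : EIL_hwh phi -> fi phi `<=` s `\ x -> sat X' rho phi ->
    permissible rho' phi Y' /\ sat Y' rho' phi.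
  move=> Lphi sphi /step[]// Z [d [/ev_stepE[_ _ _ eZ] rd pm hs]].
  have -> // : Y' = Z.
  by move: rd; rewrite re' eY' eZ => -[->].
exists Y', e'; split=> //.
  (* Either [Rev y Tt] or its negation holds at X', and permissibility of that
     formula at Y' puts [rho' y] into Y'. *)
  move=> y sy; pose phi := Rev y (@Tt Act Id).
  have Lphi : EIL_hwh phi by apply: hwh_Rev; exact: hwh_Tt.
  have sphi : fi phi `<=` s `\ x by move=> z /= [//|->].
  have [h|h] := pselect (sat X' rho phi).
    by apply: (step _ Lphi sphi h).1; right.
  have /step : EIL_hwh (Neg phi) by exact: hwh_Neg.
  by move=> /(_ sphi h)[pm _]; apply: pm; right.
move=> phi Lphi sphi; split=> [/step[]//|hs].
apply: contrapT => nhs; have /step : EIL_hwh (Neg phi) by exact: hwh_Neg.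
by move=> /(_ sphi nhs)[_].
Qed.

Lemma naming_D1 (C : conf_struct Act) s (rho : env Id C) (X : set (ev C)) x e :
  naming s rho X -> s x -> rho x = Some e -> naming (s `\ x) rho (X `\ e).
Proof.
move=> [ns inj sur] sx rx; split.
- move=> y [sy yx]; have [d rd Xd] := ns _ sy; exists d => //; split=> // de.
  by apply: yx; apply: inj => //; rewrite rd rx de.
- by move=> y z [sy _] [sz _]; exact: inj.
- move=> d [Xd de]; have [y sy ry] := sur _ Xd; exists y => //; split=> // yx.
  by apply: de; move: ry; rewrite yx rx => -[].
Qed.

Lemma naming_U1 (C : conf_struct Act) s (rho : env Id C) (X : set (ev C)) x e :
  naming (s `\ x) rho (X `\ e) -> s x -> X e -> rho x = Some e -> naming s rho X.
Proof.
move=> [ns inj sur] sx Xe rx; split.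
- move=> y sy; have [->|yx] := pselect (y = x); first by exists e.
  by have [|d rd [Xd _]] := ns y; [|exists d].
- have ne y : (s `\ x) y -> rho y <> rho x.
    by move=> /ns[d -> [_ de]]; rewrite rx => -[].
  move=> y z sy sz ryz.
  have [yx|yx] := pselect (y = x); have [zx|zx] := pselect (z = x).
  + by rewrite yx zx.
  + by case: (ne z) => //; rewrite -yx.
  + by case: (ne y) => //; rewrite -zx.
  + exact: inj.
- move=> d Xd; have [->|de] := pselect (d = e); first by exists x.
  by have [|y [sy _] ry] := sur d; [|exists y].
Qed.

(** The events of [X] are undone one at a time, mirrored in [Y] by [agree_rev]. The remaining names
    stay inside [Y'], which lacks the undone event: this restores injectivity on the way back.
    Surjectivity rests on the base case. *)
Lemma naming_transfer (C D : conf_struct Act) (X : set (ev C)) (Y : set (ev D)) s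
    rho rho' :
  [set: Id] !=set0 -> stable C -> stable D ->
  conf C X -> conf D Y -> agree X Y s rho rho' ->
  naming s rho X -> maps_into s rho' Y -> naming s rho' Y.
Proof.
move=> [x0 _] [_ stC _] [_ stD _] cX.
have finX := conf_finite cX; move: finX cX Y s.
elim/setD1_ind: X / => X _ IH cX Y s cY hXY nX ns'.
have [X0|/set0P X0] := eqVneq X set0.
  have [ns _ _] := nX.
  have s0 x : ~ s x by move=> /ns[e _]; rewrite X0.
  suff Y0 e : ~ Y e by split=> // [x y /s0|e /Y0].
  (* An event left over in [Y] is detected by a binder, which fails at the empty [X]. *)
  move=> Ye; have : sat Y rho' (Bind x0 (label e) (@Tt Act Id)) by exists e.
  move=> /hXY[]; first by apply: hwh_Bind; exact: hwh_Tt.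
    by move=> y /= [].
  by move=> d; rewrite X0 => -[].
have [e Xe cXe] := stC _ cX X0.
have [_ _ sur] := nX; have [x sx rx] := sur _ Xe.
have [Y' [e' [st' re' ms ag]]] := agree_rev hXY nX (ev_stepD1 cX cXe Xe) sx rx.
have [cY' _ Ye' eY'] := (ev_stepE _ _ _).1 st'.
apply: (naming_U1 (x := x) (e := e')) => //; rewrite -eY'.
exact: (IH e Xe cXe _ _ cY' ag (naming_D1 nX sx rx)).
Qed.

Lemma agree_name_all (C D : conf_struct Act) (X : set (ev C)) (Y : set (ev D))
    rho0 rho0' :
  infinite_set [set: Id] -> conf C X -> conf D Y ->
  agree X Y set0 rho0 rho0' ->
  exists s rho rho', [/\ naming s rho X, maps_into s rho' Y,
    agree X Y s rho rho' & forall x e e', s x -> rho x = Some e ->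
      rho' x = Some e' -> label e = label e'].
Proof.
move=> infId cX cY h0.
(* Only the events of [W] are named so far, but agreement is kept at the whole of [X] and [Y].
   Finiteness of [s] leaves a fresh identifier for the next event. *)
suff H W : finite_set W -> W `<=` X -> exists s rho rho', [/\ finite_set s,
    naming s rho W, maps_into s rho' Y,
    agree X Y s rho rho' & forall x e e', s x -> rho x = Some e ->
      rho' x = Some e' -> label e = label e'].
  have [|s [rho [rho' [_ ? ? ? ?]]]] := H X (conf_finite cX); first by [].
  by exists s, rho, rho'.
elim/setD1_ind: W / => W _ IH sWX.
have [W0|/set0P[e We]] := eqVneq W set0.
  by exists set0, rho0, rho0'; split=> //; split=> // e; rewrite W0.
have [|s [rho [rho' [fs nW ms ag lab]]]] := IH _ We.
  by move=> d [/sWX].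
have [x [_ sx]] := infinite_setN0 (infinite_setD infId fs).
have [e' [Ye' le' ag']] := agree_bind x (conf_finite cY) ag (sWX _ We).
have updE (E : conf_struct Act) (r : env Id E) d y : s y -> update r x d y = r y.
  by move=> sy; rewrite /update; case: eqP => // yx; rewrite -yx in sx.
have updx (E : conf_struct Act) (r : env Id E) d : update r x d x = Some d.
  by rewrite /update eqxx.
have sDx : (s `|` [set x]) `\ x = s.
  apply/seteqP; split=> [y [[//|-> /(_ erefl)//]]|y sy].
  by split; [left|move=> /= yx; rewrite yx in sy].
exists (s `|` [set x]), (update rho x e), (update rho' x e'); split=> //.
- by rewrite finite_setU; split=> //; exact: finite_set1.
- apply: (naming_U1 (x := x) (e := e)) => //; last by right.
  rewrite sDx; have [ns inj sur] := nW; split.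
  + by move=> y sy; rewrite updE //; exact: ns.
  + by move=> y z sy sz; rewrite !updE //; exact: inj.
  + by move=> d /sur[y sy ry]; exists y => //; rewrite updE.
- move=> y [sy|->]; last by rewrite updx; exists e'.
  by rewrite updE //; exact: ms.
- move=> y d d' [sy|->]; last by rewrite !updx => -[<-] [<-].
  by rewrite !updE //; exact: lab.
Qed.

End Agreement.

(** * Completeness: matched configurations form a bisimulation *)

Section Completeness.
Variables (Act : Type) (Id : choiceType).
Implicit Types (s : set Id) (x y : Id).

(** Equality of labels is recorded as a clause of its own, since [Rev] carries no action to test. *)
Definition matched (C D : conf_struct Act) (X : set (ev C)) (Y : set (ev D)) s
    (rho : env Id C) (rho' : env Id D) :=
  [/\ conf C X /\ conf D Y, naming s rho X, naming s rho' Y, agree X Y s rho rho'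
    & forall x e e', s x -> rho x = Some e -> rho' x = Some e' ->
        label e = label e'].

Definition named_graph (C D : conf_struct Act) s (rho : env Id C) (rho' : env Id D) :
    set (ev C * ev D) :=
  [set p | exists x, [/\ s x, rho x = Some p.1 & rho' x = Some p.2]].

Lemma matched_sym (C D : conf_struct Act) (X : set (ev C)) (Y : set (ev D)) s rho rho' :
  matched X Y s rho rho' -> matched Y X s rho' rho.
Proof.
move=> [[cX cY] nX nY ag lab]; split=> //; first exact: agree_sym.
by move=> x e e' sx rx rx'; rewrite (lab _ _ _ sx rx' rx).
Qed.

Lemma matched_rev (C D : conf_struct Act) (X X' : set (ev C)) (Y : set (ev D)) s e
    rho rho' :
  matched X Y s rho rho' -> ev_step X' e X ->
  exists x Y' e', [/\ s x, rho x = Some e, rho' x = Some e', ev_step Y' e' Y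
    & matched X' Y' (s `\ x) rho rho'].
Proof.
move=> [[cX cY] nX nY ag lab] st; have [cX' _ Xe eX'] := (ev_stepE _ _ _).1 st.
have [_ _ sur] := nX; have [x sx rx] := sur _ Xe.
have [Y' [e' [st' re' _ ag']]] := agree_rev ag nX st sx rx.
have [cY' _ Ye' eY'] := (ev_stepE _ _ _).1 st'.
exists x, Y', e'; split=> //; split=> //.
- by rewrite eX'; exact: naming_D1.
- by rewrite eY'; exact: naming_D1.
- by move=> y d d' [sy _]; exact: lab.
Qed.

(** All events of [X'], old ones included, are named afresh. This suits the weak notion of
    bisimulation, whose forward clause does not ask the new bijection to extend the old. *)
Lemma matched_fwd (C D : conf_struct Act) (X X' : set (ev C)) (Y : set (ev D)) s a
    rho rho' :
  infinite_set [set: Id] -> stable C -> stable D -> image_finite D ->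
  matched X Y s rho rho' -> act_step X a X' ->
  exists Y' t sigma sigma', act_step Y a Y' /\ matched X' Y' t sigma sigma'.
Proof.
move=> infId stC stD fD [[cX cY] nX nY ag _] st.
have [x0 _] := infinite_setN0 infId.
have ag0 : agree X Y set0 rho rho' by apply: agree_sub ag.
have [Y' st' ag'] := agree_fwd x0 fD cY ag0 st.
have cX' : conf C X' by case: st => ? [].
have cY' : conf D Y' by case: st' => ? [].
have [t [sigma [sigma' [n ms agt lab]]]] := agree_name_all infId cX' cY' ag'.
exists Y', t, sigma, sigma'; split=> //; split=> //.
exact: (naming_transfer (infinite_setN0 infId) stC stD cX' cY' agt n ms).
Qed.

(** The descent by [stable_coatom] is mirrored in [Y]. The environments stay fixed, so each
    surviving name keeps its two events. *)
Lemma matched_subconf (C D : conf_struct Act) (X Z : set (ev C)) (Y : set (ev D)) s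
    rho rho' :
  stable C -> matched X Y s rho rho' -> conf C Z -> Z `<=` X ->
  exists t W, [/\ t `<=` s, W `<=` Y & matched Z W t rho rho'].
Proof.
move=> stC hm cZ; have [[cX _] _ _ _ _] := hm.
have finX := conf_finite cX; move: finX cX Y s hm.
elim/setD1_ind: X / => X _ IH cX Y s hm sZX.
have [->|/eqP nZX] := eqVneq Z X; first by exists s, Y; split.
have [e [Xe nZe cXe]] := stable_coatom stC cZ cX sZX nZX.
have [x [Y' [e' [sx rx rx' st' hm']]]] := matched_rev hm (ev_stepD1 cX cXe Xe).
have [_ _ _ eY'] := (ev_stepE _ _ _).1 st'.
have [|t [W [ts WY' hW]]] := IH _ Xe cXe _ _ hm'.
  by move=> d Zd; split; [exact: sZX|move=> /= de; rewrite de in Zd].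
by exists t, W; split=> //; [move=> y /ts[]|move=> d /WY'; rewrite eY' => -[]].
Qed.

(** A configuration [Z] inside [X] containing [e] has a mirror [W] inside [Y] containing [e'].
    Causality in [Y] puts [d'] into [W], and its name [x] brings [d] back into [Z]. *)
Lemma matched_causal_le (C D : conf_struct Act) (X : set (ev C)) (Y : set (ev D)) s
    rho rho' x y d e d' e' :
  stable C -> matched X Y s rho rho' -> s x -> s y ->
  rho x = Some d -> rho y = Some e -> rho' x = Some d' -> rho' y = Some e' ->
  causal_le Y d' e' -> causal_le X d e.
Proof.
move=> stC hm sx sy rx ry rx' ry' le' Z cZ sZX Ze.
have [[_ _] [_ inj _] [_ inj' _] _ _] := hm.
have [t [W [ts WY [[_ cW] [msZ _ surZ] [msW _ surW] _ _]]]] :=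
  matched_subconf stC hm cZ sZX.
have ty : t y.
  have [y' ty' ry2] := surZ _ Ze.
  by rewrite (inj y y') //; [exact: ts | rewrite ry].
have We' : W e' by have [u] := msW _ ty; rewrite ry' => -[<-].
have [x' tx' rx2] := surW _ (le' _ cW WY We').
have tx : t x by rewrite (inj' x x') //; [exact: ts | rewrite rx'].
by have [u] := msZ _ tx; rewrite rx => -[<-].
Qed.

Lemma matched_conf_iso (C D : conf_struct Act) (X : set (ev C)) (Y : set (ev D)) s
    rho rho' :
  stable C -> stable D -> matched X Y s rho rho' ->
  conf_iso X Y (named_graph s rho rho').
Proof.
move=> stC stD hm; have [_ [ms inj sur] [ms' inj' sur'] _ lab] := hm; split.
- move=> [d d'] [x /= [sx rx rx']]; split=> /=.
    by have [u] := ms _ sx; rewrite rx => -[<-].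
  by have [u] := ms' _ sx; rewrite rx' => -[<-].
- move=> d Xd; have [x sx rx] := sur _ Xd; have [d' rx' Yd'] := ms' _ sx.
  exists d'; split; first by exists x.
  move=> e' [y /= [sy ry ry']]; have yx : x = y by apply: inj => //; rewrite rx ry.
  by move: rx'; rewrite yx ry' => -[].
- move=> d' Yd'; have [x sx rx'] := sur' _ Yd'; have [d rx Xd] := ms _ sx.
  exists d; split; first by exists x.
  move=> e [y /= [sy ry ry']]; have yx : x = y by apply: inj' => //; rewrite rx' ry'.
  by move: rx; rewrite yx ry => -[].
- by move=> d d' [x /= [sx rx rx']]; exact: lab rx'.
- move=> d d' e e' [x /= [sx rx rx']] [y /= [sy ry ry']].
  split=> -[le ne]; split.
  + exact: (matched_causal_le stD (matched_sym hm) sx sy rx' ry' rx ry).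
  + move=> de; apply: ne; have xy : x = y by apply: inj' => //; rewrite rx' ry' de.
    by move: rx; rewrite xy ry => -[].
  + exact: (matched_causal_le stC hm sx sy rx ry rx' ry').
  + move=> de; apply: ne; have xy : x = y by apply: inj => //; rewrite rx ry de.
    by move: rx'; rewrite xy ry' => -[].
Qed.

Lemma graph_restrict_named (C D : conf_struct Act) (X X' : set (ev C)) s x e
    (rho : env Id C) (rho' : env Id D) :
  naming s rho X -> s x -> rho x = Some e -> ev_step X' e X ->
  graph_restrict (named_graph s rho rho') X' = named_graph (s `\ x) rho rho'.
Proof.
move=> [ms inj _] sx rx /ev_stepE[_ _ Xe ->].
apply/seteqP; split=> [[d d'] [[y /= [sy ry ry']] [_ de]]|[d d'] [y /= [[sy yx] ry ry']]].
  exists y; split=> //; split=> // yx; apply: de.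
  by move: ry; rewrite yx rx => -[].
split; first by exists y.
split=> /=; first by have [u] := ms _ sy; rewrite ry => -[<-].
by move=> de; apply: yx; apply: inj => //; rewrite ry rx de.
Qed.

Lemma logic_equiv_hwh_bisimilar (C D : conf_struct Act) :
  infinite_set [set: Id] -> stable C -> stable D -> image_finite C -> image_finite D ->
  logic_equiv (@EIL_hwh Act Id) C D -> hwh_bisimilar C D.
Proof.
move=> infId stC stD fC fD heq.
exists (fun X Y f => exists s rho rho', matched X Y s rho rho' /\
  f = @named_graph C D s rho rho'); split.
- move=> X Y f [s [rho [rho' [hm ->]]]]; have [[cX cY] _ _ _ _] := hm.
  have [sf _ _ _ _] := matched_conf_iso stC stD hm.
  by split=> // p /sf[X1 Y2]; split; [exists X|exists Y].
(* With no names, agreement at the empty configurations is the assumed logical equivalence. *)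
- exists set0, (@empty_env Act Id C), (@empty_env Act Id D); split.
    have [c0 _ _] := stC; have [d0 _ _] := stD.
    have n0 (E : conf_struct Act) : naming set0 (@empty_env Act Id E) set0 by split.
    split=> // phi Lphi sphi; apply: heq => //.
    by rewrite /closed_formula -subset0.
  by apply/seteqP; split=> // p [x []].
- move=> X Y f a [s [rho [rho' [hm ->]]]]; split.
  + exact: matched_conf_iso.
  + move=> X' st.
    have [Y' [t [r [r' [st' hm']]]]] := matched_fwd infId stC stD fD hm st.
    by exists Y', (named_graph t r r'); split=> //; exists t, r, r'.
  + move=> Y' st.
    have [X' [t [r' [r [st' hm']]]]] :=
      matched_fwd infId stD stC fC (matched_sym hm) st.
    exists X', (named_graph t r r'); split=> //; exists t, r, r'; split=> //.
    exact: matched_sym.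
  + move=> X' [e st le]; have [_ nX _ _ lab] := hm.
    have [x [Y' [e' [sx rx rx' st' hm']]]] := matched_rev hm st.
    exists Y', (named_graph (s `\ x) rho rho'); split.
    * by exists e' => //; rewrite -(lab _ _ _ sx rx rx').
    * by exists (s `\ x), rho, rho'.
    * exact: graph_restrict_named st.
  + move=> Y' [e' st le]; have [_ nX _ _ lab] := hm.
    have [x [X' [e [sx rx' rx st' hm']]]] := matched_rev (matched_sym hm) st.
    exists X', (named_graph (s `\ x) rho rho'); split.
    * by exists e => //; rewrite (lab _ _ _ sx rx rx').
    * by exists (s `\ x), rho, rho'; split=> //; exact: matched_sym.
    * exact: graph_restrict_named st'.
Qed.

End Completeness.

Unset Implicit Arguments.

Theorem theorem4 (Act : Type) (Id : choiceType) (C D : conf_struct Act)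
    (Id_infinite : infinite_set [set: Id])
    (C_stable : stable C) (D_stable : stable D)
    (C_image_finite : image_finite C) (D_image_finite : image_finite D) :
  hwh_bisimilar C D <-> logic_equiv (@EIL_hwh Act Id) C D.
Proof.
split; first exact: hwh_bisimilar_logic_equiv.
exact: logic_equiv_hwh_bisimilar.
Qed.
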